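(* Let $M_n=n^b$ and $\alpha_n=n^\omega$, where $0<\omega<1$ and $b>\omega$. If $M_n\prec\sqrt n$ (i.e. $M_n/\sqrt n\to0$), then $\frac{M_nB_{M_n}}{B_n}\to0$ as $n\to\infty$.
   Context: Here $c>0$ is a constant, $\sigma_n>0$ is a sequence with $\sigma_n\to0$ (the same in both quantities), and $$B_n=\frac{\alpha_n+n}{\alpha_n}e^{-\frac{c^2}{4\sigma_n^2}},\qquad B_{M_n}=\frac{\alpha_n+M_n}{\alpha_n}e^{-\frac{c^2}{4\sigma_n^2}}.$$ *)

(* Defs.v *)
From HB Require Import structures.
From mathcomp Require Import all_boot all_order all_algebra.
From mathcomp Require Import all_classical all_reals all_analysis.

Set Implicit Arguments.
Unset Strict Implicit.
Unset Printing Implicit Defensive.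

Import Order.TTheory GRing.Theory Num.Theory.
Import numFieldNormedType.Exports.

Local Open Scope classical_set_scope.
Local Open Scope ring_scope.

(* [Bfactor c s a m] is B_m with sigma_n = s and alpha_n = a; the same s and a
   are used for B_n (m = n) and B_{M_n} (m = M_n), and m is real because M_n is. *)
Definition Bfactor (R : realType) (c s a m : R) : R :=
  (a + m) / a * expR (- (c ^+ 2 / (4 * s ^+ 2))).

(* Main.v *)
(* The exponential and the factor 1 / alpha_n cancel, so the quotient equals
   M_n (alpha_n + M_n) / (alpha_n + n).  Since omega < b gives alpha_n <= M_n,
   it is at most 2 M_n^2 / n = 2 (M_n / sqrt n)^2, which tends to 0. *)
Require Import Defs.
From HB Require Import structures.
From mathcomp Require Import all_boot all_order all_algebra.
From mathcomp Require Import all_classical all_reals all_analysis.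
From mathcomp Require Import ring.

Set Implicit Arguments.
Unset Strict Implicit.
Unset Printing Implicit Defensive.

Import Order.TTheory GRing.Theory Num.Theory.
Import numFieldNormedType.Exports.

Local Open Scope classical_set_scope.
Local Open Scope ring_scope.

Lemma Bfactor_ratio (R : realType) (c s a m k : R) : 0 < a -> 0 < k ->
  m * Bfactor c s a m / Bfactor c s a k = m * (a + m) / (a + k).
Proof.
(* The exponential is the same on both sides of the quotient, so it is made an atom [e], of which
   [field] needs only that it is nonzero. *)
move=> a0 k0; rewrite /Bfactor; set e := expR _.
have e0 : e != 0 by rewrite gt_eqF// expR_gt0.
have ak0 : a + k != 0 by rewrite gt_eqF// addr_gt0.
by field; rewrite e0 ak0 gt_eqF.
Qed.

Theorem lemma7p2 (R : realType) (c omega b : R) (sigma alpha M : nat -> R)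
  (hc : 0 < c)
  (hsigma_pos : forall n : nat, (0 < n)%N -> 0 < sigma n)
  (hsigma_lim : sigma n @[n --> \oo] --> (0 : R))
  (homega : 0 < omega < 1)
  (hb : omega < b)
  (hM : forall n : nat, (0 < n)%N -> M n = n%:R `^ b)
  (halpha : forall n : nat, (0 < n)%N -> alpha n = n%:R `^ omega)
  (hMsqrt : M n / Num.sqrt n%:R @[n --> \oo] --> (0 : R)) :
  M n * Bfactor c (sigma n) (alpha n) (M n)
    / Bfactor c (sigma n) (alpha n) n%:R @[n --> \oo] --> (0 : R).
Proof.
have B0 : ((M n / Num.sqrt n%:R) ^+ 2 *+ 2) @[n --> \oo] --> (0 : R).
  have -> : (0 : R) = (0 * 0) *+ 2 by rewrite mul0r mul0rn.
  by apply: cvgMn; apply: cvgM.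
apply: (@squeeze_cvgr _ _ _ _ (fun=> 0) _ _ _ 0 _ B0); last exact: cvg_cst.
(* Positivity of n suffices for the bounds; at n = 0 the values of [M] and [alpha] are not
   prescribed. *)
near=> n.
have n0 : (0 < n)%N by near: n; exact: nbhs_infty_gt.
have nR0 : 0 < n%:R :> R by rewrite ltr0n.
have M0 : 0 < M n by rewrite hM// powR_gt0.
have a0 : 0 < alpha n by rewrite halpha// powR_gt0.
(* Since the base n is at least 1, the power is monotone in its exponent. *)
have aM : alpha n <= M n by rewrite hM// halpha// ler_powR ?ler1n// ltW.
rewrite Bfactor_ratio// ?addr_gt0// expr_div_n (sqr_sqrtr (ltW nR0)) -mulrnAl.
apply/andP; split; first by rewrite divr_ge0 ?mulr_ge0 ?addr_ge0 ?ltW.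
(* Numerators and inverse denominators are compared separately: [aM] gives M(alpha + M) <= 2 M^2,
   and alpha > 0 gives 1/(alpha + n) <= 1/n. *)
apply: ler_pM.
- by rewrite mulr_ge0 ?addr_ge0 ?ltW.
- by rewrite invr_ge0 addr_ge0 ?ltW.
- by rewrite expr2 -mulrnAr mulr2n ler_pM2l// lerD2r.
- by rewrite lef_pV2 ?posrE ?addr_gt0// lerDr ltW.
Unshelve. all: by end_near.
Qed.
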